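(* Fix positive integers $k$ and $n$ and $p\in\{0,1\}$. Let $\lambda$ be a partition contained inside an $n\times k$ rectangle, and let $a_i=\lambda_i+(n-i)+\frac{p+1}{2}$ for $1\le i\le n$. Define $$M^{BC}_q(\lambda+p\Lambda_n):=\det\left[\mathcal{C}_{a(i,j),b(i,j)}(q)\right]_{i,j=1}^n,\qquad a(i,j)=2n-i-j+k+p+\lambda_j,\quad b(i,j)=j-i+k-\lambda_j .$$ Then $$M^{BC}_q(\lambda+p\Lambda_n)=q^{\|\overline\lambda\|}\,\frac{\prod_{i=1}^n[2k+p+2i-2]_q!\,[2a_i]_q\;\prod_{1\le i<j\le n}[a_i-a_j]_q[a_i+a_j]_q}{\prod_{i=1}^n\left[k+n-a_i+\frac{p-1}{2}\right]_q!\left[k+n+a_i+\frac{p-1}{2}\right]_q!}.$$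
   Context: $[m]_q=1+q+\cdots+q^{m-1}$, $[m]_q!=\prod_{j=1}^m[j]_q$. The $q$-Catalan triangle numbers are $\mathcal{C}_{m,r}(q)=\frac{[m+r]_q!\,[m-r+1]_q}{[r]_q!\,[m+1]_q!}$ for $m\ge0$, $0\le r\le m$, and $\mathcal{C}_{m,r}(q)=0$ if $m<0$, $r<0$, or $r>m$. A partition contained in an $n\times k$ rectangle has at most $n$ parts, each at most $k$ (padded with zeros to $n$ parts); $\overline\lambda_i=k-\lambda_{n+1-i}$ is its complement; $\|\nu\|=\sum_i(i-1)\nu_i$. Here $\Lambda_n$ only serves as notation in the name of the determinant (it is the spin fundamental weight of type $B_n$). *)

(* Defs.v *)
From HB Require Import structures.
From mathcomp Require Import all_boot all_order all_algebra.
From mathcomp Require Import ring.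

Set Implicit Arguments.
Unset Strict Implicit.
Unset Printing Implicit Defensive.

Import Order.TTheory GRing.Theory Num.Theory.
Local Open Scope ring_scope.

Definition qint (F : fieldType) (q : F) (m : nat) : F := \sum_(i < m) q ^+ i.

Definition qfact (F : fieldType) (q : F) (m : nat) : F :=
  \prod_(1 <= j < m.+1) qint q j.

(* The subtraction m - r + 1 is only evaluated for r <= m, where the truncated
   subtraction on nat is the usual one. *)
Definition qcatalan (F : fieldType) (q : F) (m r : int) : F :=
  match m, r with
  | Posz m, Posz r =>
      if (r <= m)%N then
        qfact q (m + r) * qint q (m - r + 1) / (qfact q r * qfact q (m + 1))
      else 0
  | _, _ => 0
  end.

(* Indices are 0-based: i : 'I_n stands for the mathematical index i.+1, so
   lam : 'I_n -> nat lists the n parts, zeros included, and the i-th entry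
   has mathematical index i.+1 in all the formulas below. *)
Definition in_rectangle (n k : nat) (lam : 'I_n -> nat) : Prop :=
  (forall i j : 'I_n, (i <= j)%N -> (lam j <= lam i)%N) /\
  (forall i : 'I_n, (lam i <= k)%N).

(* rev_ord sends the mathematical index i to n + 1 - i. *)
Definition complement (n k : nat) (lam : 'I_n -> nat) : 'I_n -> nat :=
  fun i => (k - lam (rev_ord i))%N.

(* The weight (i - 1) of the mathematical index i is its 0-based value. *)
Definition pnorm (n : nat) (nu : 'I_n -> nat) : nat := (\sum_(i < n) i * nu i)%N.

Definition shifted_part (n p : nat) (lam : 'I_n -> nat) (i : 'I_n) : rat :=
  (lam i)%:R + (n%:R - i.+1%:R) + (p%:R + 1) / 2.

Definition MBC (F : fieldType) (q : F) (n k p : nat) (lam : 'I_n -> nat) : F :=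
  \det (\matrix_(i < n, j < n)
    qcatalan q
      (2 * n%:Z - i.+1%:Z - j.+1%:Z + k%:Z + p%:Z + (lam j)%:Z)
      (j.+1%:Z - i.+1%:Z + k%:Z - (lam j)%:Z)).

(* The half-integers a_i enter only through the following combinations, which
   are natural numbers; hence Num.truncn recovers their exact value. *)
Section ArgumentsAreNatural.
Variables (n k p : nat) (lam : 'I_n -> nat).
Hypothesis lamP : in_rectangle k lam.
Let a := shifted_part p lam.

Lemma shifted_partE i :
  a i = (lam i + (n - i.+1))%:R + (p%:R + 1) / 2.
Proof. by rewrite /a /shifted_part natrD natrB. Qed.

Lemma double_part_nat i : 2 * a i \is a Num.nat.
Proof.
rewrite shifted_partE mulrDr mulrCA divff // mulr1.
by rewrite -natrM -[1]/(1%:R) -!natrD natr_nat.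
Qed.

Lemma sub_part_nat (i j : 'I_n) : (i < j)%N -> a i - a j \is a Num.nat.
Proof.
move=> ij; have lij := lamP.1 i j (ltnW ij).
rewrite !shifted_partE opprD addrACA subrr addr0 -natrB ?natr_nat //.
by rewrite leq_add // leq_sub2l // ltnS ltnW.
Qed.

Lemma add_part_nat i j : a i + a j \is a Num.nat.
Proof.
have -> : a i + a j = (lam i + (n - i.+1) + (lam j + (n - j.+1)) + p + 1)%:R.
  by rewrite !shifted_partE !natrD; field.
exact: natr_nat.
Qed.

Lemma denom_sub_nat i :
  k%:R + n%:R - a i + (p%:R - 1) / 2 \is a Num.nat.
Proof.
have -> : k%:R + n%:R - a i + (p%:R - 1) / 2 = (k - lam i + i)%:R.
  rewrite /a /shifted_part natrD natrB ?lamP.2 // -natr1.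
  by field.
exact: natr_nat.
Qed.

Lemma denom_add_nat i :
  k%:R + n%:R + a i + (p%:R - 1) / 2 \is a Num.nat.
Proof.
have -> : k%:R + n%:R + a i + (p%:R - 1) / 2
          = (k + n + lam i + (n - i.+1) + p)%:R.
  by rewrite /a /shifted_part !natrD natrB //; field.
exact: natr_nat.
Qed.

End ArgumentsAreNatural.

(* Main.v *)
(* Put c_j = k - lambda_j + j and d_j = k + n + lambda_j + (n - 1 - j) + p
   (0-based j). The (i, j) entry factors as a quantity depending on i only, times
   one depending on j only, times prod_{l < i} [c_j - l][d_j - l]. Since c_j + d_j
   does not depend on j, [c_j - l][d_j - l] is affine in x_j = q^{c_j} + q^{d_j},
   with l-dependent coefficients; the last factor is thus a polynomial of degree i
   in x_j, and the determinant is a Vandermonde determinant in the x_j up to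
   leading coefficients. Finally x_j - x_i factors through
   [c_j - c_i][d_j - c_i] = [a_i - a_j][a_i + a_j]. *)
Require Import Defs.
From HB Require Import structures.
From mathcomp Require Import all_boot all_order all_algebra.
From mathcomp Require Import ring zify.

Set Implicit Arguments.
Unset Strict Implicit.
Unset Printing Implicit Defensive.

Import Order.TTheory GRing.Theory Num.Theory.
Local Open Scope ring_scope.

(** The matrix is the coefficient matrix of the [P i], lower triangular by the degree bound, times
    the Vandermonde matrix of [x]. *)
Lemma det_poly_eval (R : comNzRingType) (n : nat) (P : 'I_n -> {poly R})
    (x : 'rV[R]_n) :
  (forall i, (size (P i) <= i.+1)%N) ->
  \det (\matrix_(i < n, j < n) (P i).[x 0 j]) =
  (\prod_(i < n) (P i)`_i) *
  \prod_(i < n) \prod_(j < n | (i < j)%N) (x 0 j - x 0 i).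
Proof.
move=> sP; pose L := \matrix_(i < n, j < n) (P i)`_j.
have -> : \matrix_(i < n, j < n) (P i).[x 0 j] = L *m Vandermonde n x.
  apply/matrixP=> i j; rewrite !mxE (horner_coef_wide _ (leq_trans (sP i) (ltn_ord i))).
  by apply: eq_bigr => l _; rewrite !mxE.
rewrite det_mulmx det_Vandermonde det_trig; last first.
  apply/is_trig_mxP=> i j ij; rewrite mxE nth_default //.
  exact: leq_trans (sP i) ij.
by congr (_ * _); apply: eq_bigr => i _; rewrite mxE.
Qed.

Lemma prod_lt_ord (R : comNzRingType) (n : nat) (f : nat -> 'I_n -> R) :
  \prod_(i < n) \prod_(l < i) f l i =
  \prod_(i < n) \prod_(j < n | (i < j)%N) f i j.
Proof.
transitivity (\prod_(i < n) \prod_(l < n | (l < i)%N) f l i).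
  apply: eq_bigr => i _.
  by rewrite (big_ord_widen n (fun l => f l i)) // ltnW.
by rewrite (exchange_big_dep predT).
Qed.

(** The part [k - lam i] sits at 0-based position n - 1 - i of the complement; this weight is the
    number of j > i. *)
Lemma expr_pnorm_complement (R : comNzRingType) (q : R) (n k : nat)
    (lam : 'I_n -> nat) :
  q ^+ pnorm (complement k lam) =
  \prod_(i < n) \prod_(j < n | (i < j)%N) q ^+ (k - lam i).
Proof.
rewrite /pnorm expr_sum.
transitivity (\prod_(i < n) \prod_(l < i) q ^+ (k - lam (rev_ord i))).
  by apply: eq_bigr => i _; rewrite prodr_const card_ord -exprM mulnC.
rewrite (prod_lt_ord (fun _ i => _)) (exchange_big_dep predT) //=.
rewrite (reindex_inj rev_ord_inj); apply: eq_bigr => i _ /=.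
rewrite (reindex_inj rev_ord_inj) rev_ordK; apply: eq_bigl => j /=.
by have := ltn_ord i; have := ltn_ord j; lia.
Qed.

(** Both claims share one induction: the size bound kills the coefficient of index i + 1 that the
    constant term [u i] would contribute. *)
Lemma prod_linear_poly (R : comNzRingType) (u v : nat -> R) i :
  (size (\prod_(l < i) ((u l)%:P + v l *: 'X))%R <= i.+1)%N /\
  (\prod_(l < i) ((u l)%:P + v l *: 'X))`_i = \prod_(l < i) v l.
Proof.
elim: i => [|i [sP cP]]; first by rewrite !big_ord0 size_poly1 coef1.
have Pi1 : (\prod_(l < i) ((u l)%:P + v l *: 'X))`_i.+1 = 0 by rewrite nth_default.
have mulE : \prod_(l < i.+1) ((u l)%:P + v l *: 'X) =
    u i *: (\prod_(l < i) ((u l)%:P + v l *: 'X)) +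
    v i *: ((\prod_(l < i) ((u l)%:P + v l *: 'X)) * 'X).
  by rewrite big_ord_recr /= -!mul_polyC; ring.
split; last first.
  by rewrite mulE coefD !coefZ coefMX Pi1 cP big_ord_recr /= mulr0 add0r mulrC.
apply/leq_sizeP=> j ij; rewrite mulE coefD !coefZ coefMX.
case: j ij => [//|j] ij /=; rewrite !nth_default ?mulr0 ?addr0 //.
  exact: leq_trans sP _.
by apply: leq_trans sP _; apply: ltnW.
Qed.

Section QCatalan.
Variables (F : fieldType) (q : F).
Hypotheses (q_neq0 : q != 0) (q_not_root1 : forall m, (0 < m)%N -> q ^+ m != 1).

Let subq_neq0 : 1 - q != 0.
Proof. by rewrite subr_eq0 eq_sym -[q]expr1 q_not_root1. Qed.

Lemma qintE m : qint q m = (1 - q ^+ m) / (1 - q).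
Proof.
apply: (mulIf subq_neq0); rewrite divfK // -[1 - q ^+ m]opprB subrX1.
by rewrite -mulNr opprB mulrC.
Qed.

Lemma qint_eq0 m : (qint q m == 0) = (m == 0%N).
Proof.
case: m => [|m]; first by rewrite /qint big_ord0 !eqxx.
rewrite qintE mulf_eq0 invr_eq0 (negPf subq_neq0) orbF subr_eq0 eq_sym.
by rewrite (negPf (q_not_root1 _)).
Qed.

Lemma qfactS m : qfact q m.+1 = qfact q m * qint q m.+1.
Proof. by rewrite /qfact big_nat_recr. Qed.

Lemma qfact_neq0 m : qfact q m != 0.
Proof.
elim: m => [|m IH]; first by rewrite /qfact big_geq ?oner_neq0.
by rewrite qfactS mulf_neq0 // qint_eq0.
Qed.

Lemma qfact_falling m i :
  (i <= m)%N -> qfact q m = qfact q (m - i) * \prod_(l < i) qint q (m - l).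
Proof.
elim: i => [|i IH] im; first by rewrite big_ord0 subn0 mulr1.
by rewrite IH 1?ltnW // big_ord_recr /= -(subnSK im) qfactS; ring.
Qed.

(** The indices sum to c + d - 1 - 2i and differ by d - c - 1; extending [c-i]! and [d-i]! to [c]!
    and [d]! produces the falling products. *)
Lemma qcatalan_falling c d i :
  (c < d)%N ->
  qcatalan q (d%:Z - 1 - i%:Z) (c%:Z - i%:Z) =
  qfact q (c + d - 1 - 2 * i) * qint q (d - c) / (qfact q c * qfact q d) *
  \prod_(l < i) (qint q (c - l) * qint q (d - l)).
Proof.
move=> cd; case: (leqP i c) => [ic|ci]; last first.
  (* For i > c the second index is negative and the entry is 0 by convention; on the right the
     factor at l = c is [0]_q = 0. *)
  rewrite [X in _ = _ * X](_ : _ = 0); last first.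
    rewrite (bigD1 (Ordinal ci)) //= subnn.
    by rewrite /qint big_ord0 !mul0r.
  rewrite mulr0 (_ : c%:Z - i%:Z = Negz (i - c).-1); last by lia.
  by case: (_ - _).
rewrite (_ : d%:Z - 1 - i%:Z = Posz (d - i).-1); last by lia.
rewrite (_ : c%:Z - i%:Z = Posz (c - i)); last by lia.
rewrite /qcatalan (_ : (c - i <= (d - i).-1)%N); last by lia.
rewrite (_ : ((d - i).-1 + (c - i) = c + d - 1 - 2 * i)%N); last by lia.
rewrite (_ : ((d - i).-1 - (c - i) + 1 = d - c)%N); last by lia.
rewrite (_ : ((d - i).-1 + 1 = d - i)%N); last by lia.
have id : (i <= d)%N by lia.
have := qfact_neq0 c; have := qfact_neq0 d.
rewrite big_split (qfact_falling ic) (qfact_falling id) /= !mulf_eq0 !negb_or.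
by move=> /andP[? ?] /andP[? ?]; field; do ?[apply/andP; split].
Qed.

(** Expanding (1 - q^(c-l))(1 - q^(d-l)), the variables c and d survive only in c + d and q^c +
    q^d. *)
Lemma qint_falling_affine c d l :
  (l <= c)%N -> (l <= d)%N ->
  qint q (c - l) * qint q (d - l) =
  (1 + q ^+ (c + d) / q ^+ (2 * l)) / (1 - q) ^+ 2 +
  - ((q ^+ l)^-1 / (1 - q) ^+ 2) * (q ^+ c + q ^+ d).
Proof.
move=> lc ld; have ql := expf_neq0 l q_neq0.
rewrite !qintE mul2n -addnn !exprD !expfB_cond ?(negPf q_neq0) //.
by field; do ?[apply/andP; split].
Qed.

Definition falling_coef0 S l : F := (1 + q ^+ S / q ^+ (2 * l)) / (1 - q) ^+ 2.
Definition falling_coef1 l : F := - ((q ^+ l)^-1 / (1 - q) ^+ 2).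
Definition falling_poly S i : {poly F} :=
  \prod_(l < i) ((falling_coef0 S l)%:P + falling_coef1 l *: 'X).

Lemma horner_falling_poly c d i :
  (c < d)%N ->
  (falling_poly (c + d) i).[q ^+ c + q ^+ d] =
  \prod_(l < i) (qint q (c - l) * qint q (d - l)).
Proof.
move=> cd; have term l : (l <= c)%N ->
    ((falling_coef0 (c + d) l)%:P + falling_coef1 l *: 'X).[q ^+ c + q ^+ d] =
    qint q (c - l) * qint q (d - l).
  move=> lc; rewrite hornerD hornerC hornerZ hornerX qint_falling_affine //.
  exact: leq_trans lc (ltnW cd).
rewrite /falling_poly horner_prod; case: (leqP i c) => [ic|ci].
  by apply: eq_bigr => l _; apply: term; apply: leq_trans (ltnW (ltn_ord l)) ic.
(* For l > c truncated subtraction can break the affine identity, but the factor at l = c already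
   makes both products zero. *)
rewrite (bigD1 (Ordinal ci)) // [RHS](bigD1 (Ordinal ci)) //= term //.
by rewrite subnn /qint big_ord0 !mul0r.
Qed.

(** Equal sums give di = ci + (cj - ci) + (dj - ci), so the difference is -q^ci (1 - q^(cj-ci))(1 -
    q^(dj-ci)). *)
Lemma sub_exprD_qint ci di cj dj :
  (ci + di = cj + dj)%N -> (ci <= cj)%N -> (ci <= dj)%N ->
  (q ^+ cj + q ^+ dj) - (q ^+ ci + q ^+ di) =
  - (1 - q) ^+ 2 * q ^+ ci * (qint q (cj - ci) * qint q (dj - ci)).
Proof.
move=> e /subnKC ej /subnKC ed; rewrite !qintE.
have -> : di = (ci + (cj - ci) + (dj - ci))%N by lia.
rewrite -{1}ej -{1}ed !exprD; field.
by rewrite subq_neq0.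
Qed.

Lemma det_qcatalan n S (c d : 'I_n -> nat) :
  (forall i, (c i < d i)%N) -> (forall i, (c i + d i = S)%N) ->
  (forall i j : 'I_n, (i < j)%N -> (c i <= c j)%N) ->
  (forall i : 'I_n, (i <= c i)%N) ->
  \det (\matrix_(i < n, j < n)
    qcatalan q ((d j)%:Z - 1 - i%:Z) ((c j)%:Z - i%:Z)) =
  (\prod_(i < n) \prod_(j < n | (i < j)%N) q ^+ (c i - i)) *
  ((\prod_(i < n) (qfact q (S - 1 - 2 * i) * qint q (d i - c i))) *
   (\prod_(i < n) \prod_(j < n | (i < j)%N)
      (qint q (c j - c i) * qint q (d j - c i)))) /
  (\prod_(i < n) (qfact q (c i) * qfact q (d i))).
Proof.
move=> cd cS cmono ic.
pose x : 'rV[F]_n := \row_j (q ^+ c j + q ^+ d j).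
pose r : 'rV[F]_n := \row_i qfact q (S - 1 - 2 * i).
pose s : 'rV[F]_n := \row_j (qint q (d j - c j) / (qfact q (c j) * qfact q (d j))).
have -> : (\matrix_(i < n, j < n)
    qcatalan q ((d j)%:Z - 1 - i%:Z) ((c j)%:Z - i%:Z)) =
  diag_mx r *m (\matrix_(i < n, j < n) (falling_poly S i).[x 0 j]) *m diag_mx s.
  apply/matrixP=> i j; rewrite mul_mx_diag mul_diag_mx !mxE qcatalan_falling //.
  by rewrite -horner_falling_poly // cS; ring.
rewrite !det_mulmx !det_diag det_poly_eval; last first.
  by move=> i; have [] := prod_linear_poly (falling_coef0 S) falling_coef1 i.
(* Row j has leading coefficient the product of [falling_coef1 l] over l < j; grouping by pairs
   aligns these factors with the Vandermonde differences. *)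
have -> : \prod_(i < n) (falling_poly S i)`_i =
    \prod_(i < n) \prod_(j < n | (i < j)%N) falling_coef1 i.
  rewrite -(prod_lt_ord (fun l _ => falling_coef1 l)); apply: eq_bigr => i _.
  exact: (prod_linear_poly _ _ _).2.
(* For each pair i < j, the coefficient -q^(-i)/(1-q)^2 meets the factor -(1-q)^2 q^(c i) of x_j -
   x_i, leaving q^(c i - i). *)
have vdm : (\prod_(i < n) \prod_(j < n | (i < j)%N) falling_coef1 i) *
    (\prod_(i < n) \prod_(j < n | (i < j)%N) (x 0 j - x 0 i)) =
  (\prod_(i < n) \prod_(j < n | (i < j)%N) q ^+ (c i - i)) *
  (\prod_(i < n) \prod_(j < n | (i < j)%N)
      (qint q (c j - c i) * qint q (d j - c i))).
  rewrite -!big_split; apply: eq_bigr => i _ /=.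
  rewrite -!big_split; apply: eq_bigr => j ij /=.
  have cij := cmono i j ij; have dj := leq_trans cij (ltnW (cd j)).
  rewrite !mxE sub_exprD_qint ?cS //.
  have qi := expf_neq0 i q_neq0.
  rewrite /falling_coef1 expfB_cond ?(negPf q_neq0) ?ic //.
  by field; do ?[apply/andP; split].
rewrite vdm /r /s; under eq_bigr => i _ do rewrite mxE.
under [X in _ * X = _]eq_bigr => i _ do rewrite mxE.
by rewrite !big_split /= prodfV !big_split /=; ring.
Qed.

End QCatalan.

Lemma tofracX_neq1 (K : fieldType) m :
  (0 < m)%N -> (FracField.tofrac 'X : {fraction {poly K}}) ^+ m != 1.
Proof.
move=> m_gt0; rewrite -tofracXn -tofrac1 tofrac_eq.
apply/eqP => /(congr1 (fun P : {poly K} => size P)).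
by rewrite size_polyXn size_poly1 => -[m0]; rewrite m0 in m_gt0.
Qed.

(* The identity lives in the field Q(q), with q the indeterminate. *)
Theorem theorem4p10 (n k p : nat) (lam : 'I_n -> nat)
    (hn : (0 < n)%N) (hk : (0 < k)%N) (hp : p = 0%N \/ p = 1%N)
    (hlam : in_rectangle k lam) :
  let q : {fraction {poly rat}} := FracField.tofrac 'X in
  let a := shifted_part p lam in
  MBC q k p lam =
    q ^+ pnorm (complement k lam) *
    ((\prod_(i < n)
        (qfact q (2 * k + p + 2 * i.+1 - 2)%N * qint q (Num.truncn (2 * a i)))) *
     (\prod_(i < n) \prod_(j < n | (i < j)%N)
        (qint q (Num.truncn (a i - a j)) * qint q (Num.truncn (a i + a j))))) /
    (\prod_(i < n)
       (qfact q (Num.truncn (k%:R + n%:R - a i + (p%:R - 1) / 2)) *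
        qfact q (Num.truncn (k%:R + n%:R + a i + (p%:R - 1) / 2)))).
Proof.
move=> q a; have [_ lamk] := hlam.
have truncE (x : rat) m : x = m%:R -> Num.truncn x = m by move=> ->; apply: natrK.
have q0 : q != 0 by rewrite tofrac_eq0 polyX_eq0.
(* [c] and [d] are k + n - a + (p-1)/2 and k + n + a + (p-1)/2, the arguments of the denominator
   factorials. Hence d_i - c_i = 2a_i, c_j - c_i = a_i - a_j and d_j - c_i = a_i + a_j. *)
pose c (i : 'I_n) := (k - lam i + i)%N.
pose d (i : 'I_n) := (k + n + lam i + (n - i.+1) + p)%N.
have bnd (i : 'I_n) := (lamk i, ltn_ord i).
have aE i : a i = (lam i + (n - i.+1))%:R + (p%:R + 1) / 2.
  exact: shifted_partE.
have tc i : Num.truncn (k%:R + n%:R - a i + (p%:R - 1) / 2) = c i.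
  have [lk ni] := bnd i; apply: truncE.
  by rewrite aE /c !natrD !natrB // -natr1; field.
have td i : Num.truncn (k%:R + n%:R + a i + (p%:R - 1) / 2) = d i.
  by apply: truncE; rewrite aE /d !natrD; field.
have t2 i : Num.truncn (2 * a i) = (d i - c i)%N.
  have [lk ni] := bnd i.
  have -> : (d i - c i = 2 * (lam i + (n - i.+1)) + p + 1)%N by rewrite /c /d; lia.
  by apply: truncE; rewrite aE !natrD; field.
have cmono (i j : 'I_n) : (i < j)%N -> (c i <= c j)%N.
  by move=> ij; have := hlam.1 i j (ltnW ij); rewrite /c; lia.
have tsub (i j : 'I_n) : (i < j)%N -> Num.truncn (a i - a j) = (c j - c i)%N.
  move=> ij; have lij := hlam.1 i j (ltnW ij); have [lki _] := bnd i.
  have [lkj nj] := bnd j; apply: truncE.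
  by rewrite natrB ?cmono // !aE /c !natrD !natrB // -!natr1; field.
have tadd (i j : 'I_n) : Num.truncn (a i + a j) = (d j - c i)%N.
  have [lk ni] := bnd i; have [_ nj] := bnd j.
  have -> : (d j - c i = lam i + (n - i.+1) + (lam j + (n - j.+1)) + p + 1)%N.
    by rewrite /c /d; lia.
  by apply: truncE; rewrite !aE !natrD; field.
rewrite expr_pnorm_complement.
transitivity (\det (\matrix_(i < n, j < n)
    qcatalan q ((d j)%:Z - 1 - i%:Z) ((c j)%:Z - i%:Z))).
  congr (\det _); apply/matrixP=> i j; rewrite !mxE.
  by have [lk nj] := bnd j; congr qcatalan; rewrite /c /d; lia.
(* In c_j + d_j both [lam j] and j cancel, which leaves this constant. *)
rewrite (@det_qcatalan _ q q0 _ n (2 * k + 2 * n - 1 + p)); last first.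
- by move=> i; rewrite /c leq_addl.
- exact: cmono.
- by move=> i; have [lk ni] := bnd i; rewrite /c /d; lia.
- by move=> i; have [lk ni] := bnd i; rewrite /c /d; lia.
- exact: tofracX_neq1.
congr (_ * (_ * _) / _).
- by apply: eq_bigr => i _; apply: eq_bigr => j _; rewrite /c addnK.
- rewrite !big_split /=; congr (_ * _).
    (* The row factorials [2k + 2n - 2 + p - 2i]! decrease with i, those of the target increase;
       reversing the index matches them. *)
    rewrite (reindex_inj rev_ord_inj); apply: eq_bigr => i _ /=.
    by have ni := ltn_ord i; congr (qfact q _); lia.
  by apply: eq_bigr => i _; rewrite t2.
- by apply: eq_bigr => i _; apply: eq_bigr => j ij; rewrite tsub // tadd.
- by apply: eq_bigr => i _; rewrite tc td.
Qed.
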